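(* Let $d\ge 2$. There exist constants $C,c_1,c_2>0$, depending only on $d$, such that for every odd prime power $q$ and every non-zero $r\in\mathbb{F}_q$, the sphere $S_r=\{x\in\mathbb{F}_q^d: |x|^2=r\}$ is a Salem set in the following sense: for every non-zero $m\in\mathbb{F}_q^d$, $$|\widehat{S}_r(m)|\le C\,q^{-d}\,q^{\frac{d-1}{2}},$$ and $$c_1\,q^{d-1}\le \#S_r\le c_2\,q^{d-1}.$$
   Context: $\mathbb{F}_q$ is the finite field with $q$ elements. For $x\in\mathbb{F}_q^d$, $|x|^2=x_1^2+\dots+x_d^2\in\mathbb{F}_q$. Fix a nontrivial additive character $\chi$ of $\mathbb{F}_q$ (for $q$ prime, $\chi(t)=e^{2\pi i t/q}$). $\widehat{S}_r(m)=q^{-d}\sum_{x\in S_r}\chi(-x\cdot m)$, where $x\cdot m=\sum_j x_jm_j$, is the Fourier transform of the characteristic function of $S_r$. A set $E\subset\mathbb{F}_q^d$ is called a Salem set if $|\widehat{E}(m)|\lesssim q^{-d}\sqrt{\#E}$ for every non-zero $m\in\mathbb{F}_q^d$, with implied constant independent of $q$. *)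

(* Defs.v *)
From HB Require Import structures.
From mathcomp Require Import all_boot all_order all_algebra.
From mathcomp Require Import complex.
From mathcomp Require Import reals.

Set Implicit Arguments.
Unset Strict Implicit.
Unset Printing Implicit Defensive.

Import Order.TTheory GRing.Theory Num.Theory.

Local Open Scope ring_scope.
Local Open Scope complex_scope.

Definition dotp (F : finFieldType) (d : nat) (x m : 'rV[F]_d) : F :=
  \sum_j x 0 j * m 0 j.

Definition sphere (F : finFieldType) (d : nat) (r : F) : {set 'rV[F]_d} :=
  [set x : 'rV[F]_d | \sum_j x 0 j ^+ 2 == r].

(* [chi 0 = 1] rules out the zero function, so [chi] takes values in the
   nonzero complex numbers, hence (F being finite) in the unit circle. *)
Definition additive_character (R : realType) (F : finFieldType)
    (chi : F -> R[i]) : Prop :=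
  chi 0 = 1 /\ (forall s t : F, chi (s + t) = chi s * chi t).

Definition nontrivial_character (R : realType) (F : finFieldType)
    (chi : F -> R[i]) : Prop :=
  additive_character chi /\ exists t : F, chi t != 1.

(* Fourier transform of the characteristic function of [E]. *)
Definition fourier_ind (R : realType) (F : finFieldType) (d : nat)
    (chi : F -> R[i]) (E : {set 'rV[F]_d}) (m : 'rV[F]_d) : R[i] :=
  #|F|%:R ^- d * \sum_(x in E) chi (- dotp x m).

(* Main.v *)
Require Import Defs.
From HB Require Import structures.
From mathcomp Require Import all_boot all_order all_algebra.
From mathcomp Require Import fingroup cyclic finfield qpoly qfpoly.
From mathcomp Require Import complex.
From mathcomp Require Import reals.
From mathcomp Require Import zify ring.

(**
Expand the indicator of [|x|^2 = r] in additive characters and complete the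
square in each coordinate.  Up to the term [s = 0], the sum of
[chi (- x.m)] over the sphere becomes [1/q] times
[\sum_(s != 0) chi (- s r - |m|^2 / 4s) G(s)^d], where
[G(s) = \sum_x chi (s x^2)] is the quadratic Gauss sum ([sum_sphere]).
Since [|G(s)|^2 = q] and [G(s)^2] does not depend on [s], powers of [G] with an
even exponent come out of the sum as constants of known size.  So everything
reduces to two sums over [s]: for odd [d] the Salie sum, which one more
quadratic Gauss sum evaluates explicitly ([salie_bound]), and for even [d] the
Kloosterman sum [K = \sum_(x != 0) chi (x + a / x)], for which the bound
[|K|^2 <= 4 q] of Weil is required ([kloosterman_bound]).  The case [m = 0] of
the same formula gives the size of the sphere.

The bound for [K] comes from two facts.

Let [L] be the quadratic extension of [F].  Sorting the elements of [L] by
trace and norm, and the pairs of elements of [F] by sum and product, the two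
fibres above any [(s, e)] have together exactly two elements.  Hence the
Kloosterman sum of [L] with the character [chi \o Tr] equals [2 q - K^2]
([kloosterman_quadratic]).  If [|K|^2] exceeded [4 q], then iterating this
along the tower of fields with [q^(2^j)] elements would make the ratio of
[|K_j|^2] to the size of the field grow without limit ([kloosterman_tower]).

On the other hand this ratio is bounded along the tower, by a bound depending on
[q] only ([kloosterman_stepanov]).  If [k] has [r^2] elements, where [r] is a
power of [q], the number of points on each curve
[y^q - y + s = x + a / x] is at most [r^2 + 4 q r].  As [s] varies these
curves partition the pairs [(x, y)] with [x != 0], so an upper bound for all
of them controls the deviation from the mean, and with it the character sum.
The point count is Stepanov's method with Bombieri's use of the Frobenius map:
for [y] to carry a point, the discriminant
[D(y) = (y^q - y + s)^2 - 4 a] must be a square.  One builds a nonzero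
polynomial [S] of degree about [r^2 / 2] vanishing at all such [y], as a
combination of the monomials [y^b y^(r j)] and [y^b y^(r j) D^((r+1)/2)].  At the
points in question, [S(y)^r] collapses, because [y^(r^2) = y], to a polynomial
in [y] of low degree, and there are enough free coefficients to make it
identically zero
([card_disc_square]).  That [S] itself is nonzero follows from [D] not being
a square up to square factors ([stepanov_nonvanishing]).
*)

Set Implicit Arguments.
Unset Strict Implicit.
Unset Printing Implicit Defensive.

Import Order.TTheory GRing.Theory Num.Theory.

Local Open Scope ring_scope.

(** * Squares and quadratic extensions of finite fields *)

Lemma two_neq0 (F : finFieldType) : odd #|F| -> (2 : F) != 0.
Proof.
move=> oddF; apply/negP => ch2.
have p2 : 2%N \in [pchar F] by rewrite inE /=.
have := card_pprimeChar p2; rewrite [#|_|](_ : _ = #|F|) // => cF.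
have: (1 < #|F|)%N := finNzRing_gt1 F.
by move: oddF; rewrite cF oddX orbF => /eqP ->.
Qed.

(** The unit group is cyclic.  This stands in for Euler's criterion below, where
squares are recognised by the parity of an exponent of [g]. *)
Lemma finField_generator (F : finFieldType) :
  exists g : F, (forall x, x != 0 -> exists i, x = g ^+ i)
             /\ (forall i, (g ^+ i == 1) = (#|F|.-1 %| i)%N).
Proof.
have /cyclicP[u Eu] := field_unit_group_cyclic [set: {unit F}]%G.
exists (val u); split=> [x nz_x|i].
  have : FinRing.unit F (etrans (unitfE x) nz_x) \in <[u]>%g by rewrite -Eu inE.
  by case/cycleP => i /(congr1 val) /= ->; exists i; rewrite FinRing.val_unitX.
by rewrite -FinRing.val_unitX -FinRing.val_unit1 val_eqE -order_dvdn orderE -Eu card_finField_unit.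
Qed.

Definition is_square (F : finFieldType) (x : F) := [exists z, z ^+ 2 == x].

Lemma is_square_sqr (F : finFieldType) (z : F) : is_square (z ^+ 2).
Proof. by apply/existsP; exists z. Qed.

Lemma is_squareP (F : finFieldType) (x : F) :
  reflect (exists z, x = z ^+ 2) (is_square x).
Proof.
by apply: (iffP existsP) => [[z /eqP <-]|[z ->]]; exists z.
Qed.

Lemma nonsquare_mul (F : finFieldType) (x y : F) :
  ~~ is_square x -> ~~ is_square y -> is_square (x * y).
Proof.
have [g [gP _]] := finField_generator F.
have odd_exp z : ~~ is_square z -> exists2 i, z = g ^+ i & odd i.
  move=> nsq; case: (eqVneq z 0) nsq => [->|/gP[i ->]] nsq.
    by move/negP: nsq; case; apply/is_squareP; exists 0; rewrite expr0n.
  exists i => //; apply: contraR nsq => /even_halfK <-.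
  by rewrite -mul2n mulnC exprM is_square_sqr.
move=> /odd_exp[i -> oi] /odd_exp[j -> oj]; rewrite -exprD.
have: ~~ odd (i + j) by rewrite oddD oi oj.
by move=> /even_halfK <-; rewrite -mul2n mulnC exprM is_square_sqr.
Qed.

(** Squaring is not injective, as [1] and [-1] are distinct, hence not surjective. *)
Lemma nonsquare_exists (F : finFieldType) :
  odd #|F| -> exists x : F, ~~ is_square x.
Proof.
move=> oddF; apply/existsP; rewrite -negb_forall; apply/negP => /forallP sqF.
have inj_sqr : injective (fun z : F => z ^+ 2).
  have ex z : exists w : F, z == w ^+ 2.
    by have /is_squareP[w ->] := sqF z; exists w.
  apply: (can_inj (g := fun z => xchoose (ex z))); apply: canF_sym => z.
  by rewrite -(eqP (xchooseP (ex z))).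
have: (1 : F) = -1 by apply: inj_sqr; rewrite sqrrN.
by move/eqP; rewrite -subr_eq0 opprK; apply/negP; apply: two_neq0.
Qed.

Lemma card_sqrt (F : finFieldType) (x : F) :
  (#|[pred z : F | z ^+ 2 == x]| <= 2)%N.
Proof.
case: (pickP [pred z : F | z ^+ 2 == x]) => [w /eqP <-|/eq_card0->//].
apply: leq_trans (_ : #|[:: w; -w]| <= _)%N; last exact: (card_size [:: w; -w]).
by apply/subset_leq_card/subsetP => z; rewrite !inE eqf_sqr.
Qed.

Lemma card_sqrt_sqr (F : finFieldType) (w : F) : odd #|F| -> w != 0 ->
  #|[pred z : F | z ^+ 2 == w ^+ 2]| = 2%N.
Proof.
move=> oddF nz_w; rewrite (eq_card (_ : _ =i pred2 w (-w))); last first.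
  by move=> z; rewrite !inE eqf_sqr.
have w_neq : w != - w.
  rewrite -subr_eq0 opprK -mulr2n -mulr_natl mulf_eq0 negb_or nz_w.
  by rewrite two_neq0.
by rewrite card2 w_neq.
Qed.

Lemma quadratic_extension (F : finFieldType) : odd #|F| ->
  exists (L : finFieldType) (f : {rmorphism F -> L}), #|L| = (#|F| ^ 2)%N.
Proof.
move=> /nonsquare_exists[a nsq_a].
pose p : {poly F} := 'X^2 - a%:P.
have sz_p : size p = 3 by rewrite size_XnsubC.
have irr_p : irreducible_poly p.
  apply: cubic_irreducible => [|x]; first by rewrite sz_p.
  rewrite /root !hornerE subr_eq0; apply: contra nsq_a => /eqP <-.
  exact: is_square_sqr.
have mi : monic_irreducible_poly p by split=> //; rewrite monicXnsubC.
exists {poly %/ p with mi}, (GRing.in_alg {poly %/ p with mi}).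
by rewrite card_qfpoly sz_p.
Qed.

Section QuadraticExtension.
Variables (F L : finFieldType) (f : {rmorphism F -> L}).
Hypotheses (oddF : odd #|F|) (cardL : #|L| = (#|F| ^ 2)%N).

(** For a generator [g] of the units of [L], a nonzero element of [F] is a power of
[g^(q+1)], and [q + 1] is even. *)
Lemma sqrt_in_quadratic_extension (x : F) : exists w, f x = w ^+ 2.
Proof.
have [-> |nz_x] := eqVneq x 0; first by exists 0; rewrite rmorph0 expr0n.
have [g [gP g1]] := finField_generator L.
have /gP[i fxE] : f x != 0 by rewrite fmorph_eq0.
have: f x ^+ #|F|.-1 == 1.
  rewrite -rmorphXn /= -(rmorph1 f) (inj_eq (fmorph_inj _)).
  rewrite -(inj_eq (mulfI nz_x)) -exprS mulr1 (ltn_predK (finNzRing_gt1 F)).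
  by rewrite expf_card.
rewrite fxE -exprM g1 cardL.
have -> : ((#|F| ^ 2).-1 = #|F|.+1 * #|F|.-1)%N.
  by have := finNzRing_gt1 F; case: #|F| => // n _; rewrite /=; lia.
rewrite dvdn_pmul2r; last by have := finNzRing_gt1 F; case: #|F| => [|[|n]].
move=> /(dvdn_trans (n := #|F|.+1) (d := 2)); rewrite dvdn2 /= oddF => /(_ isT).
by rewrite dvdn2 => /even_halfK <-; exists (g ^+ i./2); rewrite -exprM muln2.
Qed.

(** The polynomial [X^q - X] already has the [q] elements of [F] as roots. *)
Lemma quadratic_extension_fixed (y : L) : y ^+ #|F| = y -> exists x, f x = y.
Proof.
move=> fix_y; suff /existsP[x /eqP fx] : [exists x, f x == y] by exists x.
apply: contraT => /existsPn noy.
pose s := y :: [seq f x | x : F].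
have /max_poly_roots : ('X^#|F| - 'X : {poly L}) != 0.
  by rewrite -size_poly_eq0 size_polyDl ?size_polyXn // size_polyN size_polyX ltnS finNzRing_gt1.
move/(_ s); rewrite size_polyDl ?size_polyXn; last first.
  by rewrite size_polyN size_polyX ltnS finNzRing_gt1.
rewrite /= size_map -cardE ltnn => H.
suff: false by []; apply: H => /=.
  rewrite rootE !hornerE fix_y subrr eqxx /=.
  apply/allP => _ /mapP[x _ ->].
  by rewrite rootE !hornerE -rmorphXn /= expf_card subrr.
rewrite map_inj_uniq ?enum_uniq ?andbT; last exact: fmorph_inj.
by apply/mapP => -[x _ yE]; have := noy x; rewrite yE eqxx.
Qed.

End QuadraticExtension.

(** A positive power of [q] is the size of [L], hence a power of the characteristic.
In this form the exponent [q] is kept fixed while the field grows. *)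
Lemma pchar_nat_card (L : finFieldType) q m :
  #|L| = (q ^ m.+1)%N -> [pchar L].-nat q.
Proof.
move=> cardL.
have [p pr_p pL] := finPcharP L.
have := card_pprimeChar pL; rewrite [#|_|](_ : _ = #|L|) // => cL.
rewrite (eq_pnat _ (pcharf_eq pL)).
have : p.-nat #|L| by rewrite cL pnatX pnat_id.
by rewrite cardL pnatX orbF.
Qed.

Lemma exprD_card (L : finFieldType) q m : #|L| = (q ^ m.+1)%N ->
  forall x y : L, (x + y) ^+ q = x ^+ q + y ^+ q.
Proof. by move=> cardL x y; apply: exprDn_pchar; apply: pchar_nat_card cardL. Qed.

(** * Additive characters *)

Section Characters.
Variables (R : realType) (F : finFieldType) (chi : F -> R[i]).
Hypothesis nchi : nontrivial_character chi.

Lemma addchar0 : chi 0 = 1. Proof. by case: nchi => -[]. Qed.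

Lemma addcharD s t : chi (s + t) = chi s * chi t.
Proof. by case: nchi => -[]. Qed.

Lemma addcharMn x n : chi (x *+ n) = chi x ^+ n.
Proof. by elim: n => [|n IH]; rewrite ?addchar0 // mulrS exprS addcharD IH. Qed.

Lemma addchar_norm x : `|chi x| = 1.
Proof.
have q_gt0 : (0 < #|F|)%N by apply: ltn_trans (finNzRing_gt1 F).
apply/eqP; rewrite -(@pexpr_eq1 _ _ #|F|) // -normrX -addcharMn.
have [p pr_p pF] := finPcharP F.
have := card_pprimeChar pF; rewrite [#|_|](_ : _ = #|F|) // => cF.
have p_dv : (p %| #|F|)%N.
  rewrite cF dvdn_exp // lognE pr_p q_gt0 /=.
  rewrite ifT //; move: (finNzRing_gt1 F); rewrite cF.
  by case: (logn _ _) => // n _; rewrite expnS dvdn_mulr.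
by rewrite -(divnK p_dv) mulrnA (mulrn_pchar pF) addchar0 normr1.
Qed.

Lemma addchar_neq0 x : chi x != 0.
Proof. by rewrite -normr_eq0 addchar_norm oner_eq0. Qed.

Lemma addcharN x : chi (- x) = (chi x)^*.
Proof.
apply: (mulfI (addchar_neq0 x)); rewrite -addcharD subrr addchar0 -normCK addchar_norm.
by rewrite expr1n.
Qed.

Lemma sum_char : \sum_x chi x = 0.
Proof.
have [t chi_t] := nchi.2.
apply/eqP; suff: (chi t - 1) * \sum_x chi x == 0.
  by rewrite mulf_eq0 subr_eq0 (negbTE chi_t).
rewrite mulrBl mul1r mulr_sumr subr_eq0 [X in _ == X](reindex_inj (addrI t)).
by apply/eqP; apply: eq_bigr => x _; rewrite addcharD.
Qed.

Lemma sum_char_scale a : \sum_x chi (a * x) = (a == 0)%:R * #|F|%:R.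
Proof.
have [->|nz_a] := eqVneq a 0.
  rewrite mul1r (eq_bigr (fun=> 1)); last by move=> x _; rewrite mul0r addchar0.
  by rewrite sumr_const.
by rewrite mul0r -[RHS]sum_char [RHS](reindex_inj (mulfI nz_a)).
Qed.

Lemma sum_char_scale_neq0 a :
  \sum_(x | x != 0) chi (a * x) = (a == 0)%:R * #|F|%:R - 1.
Proof.
by rewrite -sum_char_scale [in RHS](bigD1 0) //= mulr0 addchar0 addrAC subrr add0r.
Qed.

End Characters.

(** Compose a coordinate of [F] over its prime field with [n |-> z^n], for a root
[z] of [1 + X + ... + X^(p-1)]. *)
Lemma nontrivial_character_exists (R : realType) (F : finFieldType) :
  exists chi : F -> R[i], nontrivial_character chi.
Proof.
have [p pr_p pF] := finPcharP F.
pose P : {poly R[i]} := \sum_(i < p) 'X^i.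
have [z Pz0] : exists z, root P z.
  apply/closed_rootP; rewrite /P.
  have -> : \sum_(i < p) 'X^i = \poly_(i < p) 1 :> {poly R[i]}.
    by rewrite poly_def; apply: eq_bigr => i _; rewrite scale1r.
  by rewrite size_poly_eq ?oner_eq0 // gtn_eqF // prime_gt1.
have sum0 : \sum_(i < p) z ^+ i = 0.
  move: Pz0; rewrite rootE /P horner_sum => /eqP.
  by under eq_bigr do rewrite hornerXn.
have zp : z ^+ p = 1.
  by apply/eqP; rewrite -subr_eq0 subrX1 sum0 mulr0.
have z1 : z != 1.
  apply/eqP => z1; move: sum0; rewrite z1.
  under eq_bigr do rewrite expr1n.
  by move/eqP; rewrite sumr_const card_ord pnatr_eq0 gtn_eqF ?prime_gt0.
pose L := pPrimeCharType pF.
have [i nz_i] : exists i, coord (vbasis {:L}) i (1 : L) != 0.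
  apply/existsP; apply: contraT => /existsPn c0.
  have /eqP := coord_vbasis (memvf (1 : L)); rewrite big1 ?oner_eq0 // => i _.
  by have := c0 i; rewrite negbK => /eqP ->; rewrite scale0r.
pose c (x : L) : 'F_p := coord (vbasis {:L}) i x.
have cD x y : c (x + y) = c x + c y by rewrite /c linearD.
exists (fun x : F => z ^+ (c x)); split; first split.
- by rewrite /c linear0.
- move=> x y; rewrite cD -exprD -[RHS](expr_mod _ zp); congr (z ^+ _).
  by rewrite -[X in (_ = _ %% X)%N](Fp_cast pr_p).
exists ((c 1)^-1 *: (1 : L)).
have -> : c ((c 1)^-1 *: (1 : L)) = 1.
  by transitivity ((c 1)^-1 * c 1); [exact: linearZ_LR | exact: mulVf].
by [].
Qed.

(** * Sum and product against trace and norm *)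

Section SumProduct.
Variables (F : finFieldType) (s e : F).
Hypothesis oddF : odd #|F|.

(** The pairs with sum [s] and product [e] are the [((s + z) / 2, (s - z) / 2)] with
[z^2] equal to the discriminant; [card_trace_norm] is the same
computation in [L], where [z] has to be [q]-Frobenius anti-invariant for
[(s + z) / 2] and [(s - z) / 2] to be conjugate. *)
Lemma card_sum_prod : #|[pred x : F * F | (x.1 + x.2 == s) && (x.1 * x.2 == e)]|
  = #|[pred z : F | z ^+ 2 == s ^+ 2 - 4 * e]|.
Proof.
have nz2 := two_neq0 oddF.
have nz4 : (4 : F) != 0 by rewrite (natrM F 2 2) mulf_neq0.
pose h (z : F) := ((s + z) / 2, (s - z) / 2).
have inj_h : injective h.
  by move=> z w [] /(mulIf (invr_neq0 nz2)) /addrI.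
rewrite -[RHS](card_image inj_h); apply: eq_card => -[x y]; rewrite !inE /=.
apply/andP/imageP => [[/eqP sE /eqP eE]|[z]].
  exists (x - y); first by rewrite inE -sE -eE; apply/eqP; ring.
  by rewrite /h -sE; congr pair; field.
rewrite inE => /eqP zz [-> ->]; split; apply/eqP; first by field.
have -> : e = (s ^+ 2 - z ^+ 2) / 4 by rewrite zz; field; rewrite ?nz2 ?nz4.
by field; rewrite ?nz2 ?nz4.
Qed.

Variables (L : finFieldType) (f : {rmorphism F -> L}).
Hypotheses (cardL : #|L| = (#|F| ^ 2)%N).

Lemma card_trace_norm :
  #|[pred y : L | (y + y ^+ #|F| == f s) && (y * y ^+ #|F| == f e)]|
  = #|[pred z : L | (z ^+ #|F| == - z) && (z ^+ 2 == f (s ^+ 2 - 4 * e))]|.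
Proof.
have nz2 : (2 : L) != 0 by apply: two_neq0; rewrite cardL oddX oddF.
have nz4 : (4 : L) != 0 by rewrite (natrM L 2 2) mulf_neq0.
have fixf x : f x ^+ #|F| = f x by rewrite -rmorphXn /= expf_card.
have fix2 : (2^-1 : L) ^+ #|F| = 2^-1.
  by rewrite exprVn -[2](rmorph_nat f) fixf.
pose h (z : L) := (f s + z) / 2.
have inj_h : injective h by move=> z w /(mulIf (invr_neq0 nz2)) /addrI.
have hq z : z ^+ #|F| = - z -> h z ^+ #|F| = (f s - z) / 2.
  by move=> zq; rewrite exprMn fix2 (exprD_card cardL) fixf zq.
rewrite -[RHS](card_image inj_h); apply: eq_card => y; rewrite !inE.
have -> : f (s ^+ 2 - 4 * e) = f s ^+ 2 - 4 * f e.
  by rewrite rmorphB rmorphXn rmorphM /= rmorph_nat.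
apply/andP/imageP => [[/eqP sE /eqP eE]|[z]].
  exists (y - y ^+ #|F|); last by rewrite /h -sE; field.
  rewrite inE -sE -eE; apply/andP; split; last by apply/eqP; ring.
  have Nq : (- y ^+ #|F|) ^+ #|F| = - y.
    by rewrite -mulN1r exprMn -signr_odd oddF -exprM mulnn -cardL expf_card expr1 mulN1r.
  by rewrite (exprD_card cardL) Nq opprB addrC.
rewrite inE => /andP[/eqP zq /eqP zz] ->; rewrite hq // /h.
split; apply/eqP; first by field.
have -> : f e = (f s ^+ 2 - z ^+ 2) / 4 by rewrite zz; field; rewrite ?nz2 ?nz4.
by field; rewrite ?nz2 ?nz4.
Qed.

(** The polynomial [X^2 - s X + e] over [F] has its roots in [L].  Two distinct roots
are either both in [F], giving two ordered pairs, or conjugate, giving two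
elements of [L]; a double root counts once on each side. *)
Lemma card_sum_prod_trace_norm :
  (#|[pred y : L | (y + y ^+ #|F| == f s)%R && (y * y ^+ #|F| == f e)%R]|
  + #|[pred x : F * F | (x.1 + x.2 == s)%R && (x.1 * x.2 == e)%R]| = 2)%N.
Proof.
have oddL : odd #|L| by rewrite cardL oddX.
rewrite card_sum_prod card_trace_norm; set D := s ^+ 2 - 4 * e.
have [w fD] := sqrt_in_quadratic_extension f oddF cardL D.
have [D0|nzD] := eqVneq D 0.
  rewrite D0 rmorph0 (eq_card (_ : _ =i pred1 0)) ?card1; last first.
    move=> z; rewrite !inE expf_eq0 /=; apply: andb_idl => /eqP ->.
    by rewrite oppr0 expf_eq0 eqxx andbT (ltn_trans _ (finNzRing_gt1 F)).
  by rewrite (eq_card (_ : _ =i pred1 0)) ?card1 // => z; rewrite !inE expf_eq0.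
have nzw : w != 0 by move: nzD; rewrite -(fmorph_eq0 f) fD expf_eq0.
have : (w ^+ #|F|) ^+ 2 == w ^+ 2.
  by rewrite exprAC -fD -rmorphXn /= expf_card.
have wNw : w != - w.
  rewrite -subr_eq0 opprK -mulr2n -mulr_natl mulf_eq0 negb_or nzw.
  by rewrite two_neq0.
rewrite fD eqf_sqr => /orP[] /eqP wq.
  have [v fv] := quadratic_extension_fixed f wq.
  have DE : D = v ^+ 2 by apply: (fmorph_inj f); rewrite fD rmorphXn /= fv.
  rewrite DE card_sqrt_sqr -1?(fmorph_eq0 f) ?fv // eq_card0 // => z.
  rewrite !inE eqf_sqr; apply/negP => /andP[zq /orP[]/eqP zE].
    by move: zq; rewrite zE wq (negbTE wNw).
  by move: zq; rewrite zE -mulN1r exprMn -signr_odd oddF expr1 !mulN1r wq opprK eq_sym (negbTE wNw).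
rewrite (eq_card (_ : _ =i [pred z | z ^+ 2 == w ^+ 2])); last first.
  move=> z; rewrite !inE; apply: andb_idl; rewrite eqf_sqr => /orP[]/eqP ->.
    by rewrite wq.
  by rewrite -mulN1r exprMn -signr_odd oddF expr1 !mulN1r wq.
rewrite card_sqrt_sqr // eq_card0 // => z; rewrite !inE; apply/negP => /eqP zz.
have : f z ^+ 2 == w ^+ 2 by rewrite -rmorphXn /= zz fD.
rewrite eqf_sqr => /orP[]/eqP fz; move: wNw; rewrite -wq.
  by rewrite -fz -rmorphXn /= expf_card eqxx.
move/eqP: fz; rewrite -eqr_oppLR => /eqP <-.
by rewrite -rmorphN -rmorphXn /= expf_card eqxx.
Qed.

End SumProduct.

(** * Kloosterman sums in a quadratic extension *)

Definition kloosterman (R : realType) (F : finFieldType) (chi : F -> R[i])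
  (a : F) : R[i] := \sum_(x | x != 0) chi (x + a / x).

(** The trace is a polynomial map of degree [q], smaller than the size of [L]. *)
Lemma trace_nonzero (F L : finFieldType) : #|L| = (#|F| ^ 2)%N ->
  exists y : L, y + y ^+ #|F| != 0.
Proof.
move=> cardL; apply/existsP; apply: contraT => /existsPn tr0.
have q_gt1 := finNzRing_gt1 F.
have sz : size ('X^#|F| + 'X : {poly L}) = #|F|.+1.
  by rewrite size_polyDl ?size_polyXn // size_polyX ltnS.
have /max_poly_roots : ('X^#|F| + 'X : {poly L}) != 0 by rewrite -size_poly_eq0 sz.
move/(_ (enum L)); rewrite sz -cardE enum_uniq cardL => H.
suff: (#|F| ^ 2 < #|F|.+1)%N by rewrite -mulnn; move: #|F| q_gt1 => q; nia.
apply: H => //; apply/allP => y _.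
by rewrite rootE !hornerE addrC; have := tr0 y; rewrite negbK.
Qed.

Lemma kloosterman_sqr (R : realType) (F : finFieldType) (chi : F -> R[i]) (a : F) :
  nontrivial_character chi -> a != 0 ->
  kloosterman chi a ^+ 2 =
  \sum_(p : F * F | p.2 != 0)
     #|[pred x : F * F | (x.1 + x.2 == p.1) && (x.1 * x.2 == p.2)]|%:R
       * chi (p.1 + a * p.1 / p.2).
Proof.
move=> nchi nz_a; rewrite expr2 /kloosterman big_distrl /=.
under eq_bigr do rewrite big_distrr /=.
rewrite pair_big /=.
pose h (x : F * F) := (x.1 + x.2, x.1 * x.2).
rewrite (partition_big h (fun p => p.2 != 0)) /=; last first.
  by move=> x /andP[]; apply: mulf_neq0.
apply: eq_bigr => -[s e] /= nz_e.
rewrite -sum1_card natr_sum mulr_suml; apply: eq_big => [[x y]|[x y]] /=.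
  rewrite !inE /h xpair_eqE /=; apply: andb_idl => /andP[_ /eqP exy].
  by move: nz_e; rewrite -exy mulf_eq0 negb_or.
move=> /andP[/andP[nzx nzy] /eqP[<- <-]]; rewrite mul1r -(addcharD nchi).
by congr chi; field; rewrite ?nzx ?nzy.
Qed.

(** For fixed [e] the summand is a character of [s], trivial only for [e = - a]. *)
Lemma sum_char_trace_norm (R : realType) (F : finFieldType) (chi : F -> R[i]) (a : F) :
  nontrivial_character chi -> a != 0 ->
  \sum_(p : F * F | p.2 != 0) chi (p.1 + a * p.1 / p.2) = #|F|%:R.
Proof.
move=> nchi nz_a.
rewrite -(pair_big predT (fun e => e != 0) (fun s e => chi (s + a * s / e))) /=.
rewrite exchange_big (bigD1 (- a)) ?oppr_eq0 //= [X in _ + X]big1 ?addr0; last first.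
  move=> e /andP[nz_e e_a].
  transitivity (\sum_s chi ((1 + a / e) * s)).
    by apply: eq_bigr => s _; congr chi; field.
  rewrite sum_char_scale // (_ : _ == 0 = false) ?mul0r //; apply/negbTE.
  apply: contra e_a; rewrite addrC addr_eq0 => /eqP ae.
  by rewrite -(divfK nz_e a) ae mulN1r opprK.
rewrite (eq_bigr (fun=> 1)) ?sumr_const // => s _.
by rewrite (_ : _ + _ = 0) ?addchar0 //; field; rewrite oppr_eq0.
Qed.

(** Write the new sum over [(trace, norm)] and [K^2] over [(sum, product)].  Both
summands are [chi (s + a s / e)], with multiplicities adding up to [2], so the
two sums add up to [2 q].  The fourth clause passes invariance under a fixed
Frobenius power up the tower, where it makes [psi] trivial on [y^q - y]. *)
Lemma kloosterman_quadratic (R : realType) (F : finFieldType) (chi : F -> R[i])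
    (a : F) :
  odd #|F| -> nontrivial_character chi -> a != 0 ->
  exists (L : finFieldType) (psi : L -> R[i]) (b : L),
  [/\ #|L| = (#|F| ^ 2)%N, nontrivial_character psi, b != 0,
      (forall q m, #|F| = (q ^ m.+1)%N -> (forall x, chi (x ^+ q) = chi x) ->
         forall y, psi (y ^+ q) = psi y)
    & kloosterman psi b = 2 * #|F|%:R - kloosterman chi a ^+ 2].
Proof.
move=> oddF nchi nz_a.
have [L [f cardL]] := quadratic_extension oddF.
have frobD := exprD_card cardL.
have frob2 (y : L) : (y ^+ #|F|) ^+ #|F| = y by rewrite -exprM mulnn -cardL expf_card.
have fixf x : f x ^+ #|F| = f x by rewrite -rmorphXn /= expf_card.
have trP y : exists x, f x == y + y ^+ #|F|.
  have [|x fx] := quadratic_extension_fixed f (y := y + y ^+ #|F|).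
    by rewrite frobD frob2 addrC.
  by exists x; rewrite fx.
have nmP y : exists x, f x == y * y ^+ #|F|.
  have [|x fx] := quadratic_extension_fixed f (y := y * y ^+ #|F|).
    by rewrite exprMn frob2 mulrC.
  by exists x; rewrite fx.
pose tr y := xchoose (trP y); pose nm y := xchoose (nmP y).
have trE y : f (tr y) = y + y ^+ #|F| := eqP (xchooseP (trP y)).
have nmE y : f (nm y) = y * y ^+ #|F| := eqP (xchooseP (nmP y)).
have injf := fmorph_inj f.
have trD y z : tr (y + z) = tr y + tr z.
  by apply: injf; rewrite rmorphD !trE frobD addrACA.
have tr0 : tr 0 = 0.
  by apply: injf; rewrite trE rmorph0 expr0n add0r gtn_eqF // (ltn_trans _ (finNzRing_gt1 F)).
have trZ x y : tr (f x * y) = x * tr y.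
  by apply: injf; rewrite rmorphM /= !trE exprMn fixf mulrDr.
have q_gt0 : (0 < #|F|)%N by apply: ltn_trans (finNzRing_gt1 F).
have nm_eq0 y : (nm y == 0) = (y == 0).
  by rewrite -(fmorph_eq0 f) nmE mulf_eq0 expf_eq0 q_gt0 orbb.
pose psi y := chi (tr y).
exists L, psi, (f a); split => //.
- split; first by split=> [|y z]; rewrite /psi ?tr0 ?trD ?(addchar0 nchi) ?(addcharD nchi).
  have [y nz_y] := trace_nonzero cardL.
  have nz_tr : tr y != 0 by rewrite -(fmorph_eq0 f) trE.
  have [t chit] := nchi.2; exists (f (t / tr y) * y).
  by rewrite /psi trZ divfK.
- by rewrite fmorph_eq0.
- move=> q m cardF inv y; rewrite /psi -[RHS]inv; congr chi.
  apply: injf; rewrite rmorphXn /= !trE.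
  by rewrite (@exprD_card _ q (m.+1 * 2).-1) 1?exprAC // cardL cardF -expnM muln2.
have -> : kloosterman psi (f a) =
  \sum_(p : F * F | p.2 != 0)
     #|[pred y : L | (y + y ^+ #|F| == f p.1) && (y * y ^+ #|F| == f p.2)]|%:R
       * chi (p.1 + a * p.1 / p.2).
  pose h y := (tr y, nm y); rewrite /kloosterman.
  rewrite (partition_big h (fun p => p.2 != 0)) /=; last by move=> y; rewrite nm_eq0.
  apply: eq_bigr => -[s e] /= nz_e.
  rewrite -sum1_card natr_sum mulr_suml; apply: eq_big => [y|y] /=.
    rewrite !inE /h xpair_eqE /= -trE -nmE !(inj_eq injf); apply: andb_idl.
    by move=> /andP[_ /eqP nmy]; rewrite -nm_eq0 nmy.
  move=> /andP[nzy /eqP[<- <-]]; rewrite mul1r /psi; congr chi.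
  apply: injf; rewrite trE rmorphD rmorphM rmorphM /= fmorphV nmE trE.
  rewrite frobD exprMn exprVn fixf.
  by field; rewrite nzy expf_neq0.
rewrite kloosterman_sqr // -(sum_char_trace_norm nchi nz_a) mulr_sumr -sumrB.
apply: eq_bigr => -[s e] /= _; rewrite -mulrBl; congr (_ * _).
by rewrite -(card_sum_prod_trace_norm s e oddF f cardL) natrD addrK.
Qed.

(** * Polynomials in [y] and [y^r] *)

(** Elements of [{poly {poly k}}] stand for polynomials in an inner variable [y] and
an outer variable, for which [y^r] is substituted later. *)
Definition inner_size_le (k : fieldType) n (w : {poly {poly k}}) :=
  forall i, (size (w`_i)%R <= n)%N.

Section InnerSize.
Variables (k : fieldType).
Implicit Types u v w : {poly {poly k}}.

Lemma inner_size_leW m n w : (m <= n)%N -> inner_size_le m w -> inner_size_le n w.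
Proof. by move=> le_mn wm i; apply: leq_trans le_mn. Qed.

Lemma inner_size_leC n (c : {poly k}) : (size c <= n)%N -> inner_size_le n c%:P.
Proof. by move=> le_cn i; rewrite coefC; case: ifP; rewrite ?size_poly0. Qed.

Lemma inner_size_leM m n u v :
  inner_size_le m u -> inner_size_le n v -> inner_size_le (m + n).-1 (u * v).
Proof.
move=> um vn i; rewrite coefM; apply: (big_ind (fun w : {poly k} => (size w <= (m + n).-1)%N)).
- by rewrite size_poly0.
- by move=> x y sx sy; rewrite (leq_trans (size_polyD _ _)) // geq_max sx.
- move=> j _; apply: leq_trans (size_polyMleq _ _) _.
  by rewrite -!subn1 leq_sub2r // leq_add.
Qed.

Lemma inner_size_leB n u v :
  inner_size_le n u -> inner_size_le n v -> inner_size_le n (u - v).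
Proof.
move=> un vn i; rewrite coefB (leq_trans (size_polyD _ _)) // geq_max un.
by rewrite size_polyN vn.
Qed.

(** Substituting [y^r] for the outer variable loses nothing as long as the inner
degrees stay below [r]: this is the expansion in base [y^r]. *)
Lemma horner_Xn_eq0 r w : inner_size_le r w -> w.['X^r] = 0 -> w = 0.
Proof.
elim/poly_ind: w => // w c IH small.
have sc : (size c <= r)%N.
  by have := small 0%N; rewrite coefD coefMX coefC add0r.
rewrite hornerMXaddC; have [w0|nzw] := eqVneq w.['X^r] 0.
  have -> : w = 0.
    by apply: IH => // i; have := small i.+1; rewrite coefD coefMX coefC /= addr0.
  by rewrite horner0 !mul0r !add0r => ->; rewrite polyC0.
move/eqP; rewrite -size_poly_eq0 size_polyDl ?size_mulXn //.
  by rewrite addn_eq0 size_poly_eq0 (negbTE nzw) andbF.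
by rewrite (leq_ltn_trans sc) // -[X in (X < _)%N]addn0 ltn_add2l lt0n size_poly_eq0.
Qed.

(** Raising to the power [r] is Frobenius, so [p^r] is a polynomial in [y^r] with
constant coefficients. *)
Lemma pchar_expr_horner_Xn r (p : {poly k}) : (0 < r)%N -> [pchar k].-nat r ->
  exists2 w, inner_size_le 1 w & w.['X^r] = p ^+ r.
Proof.
move=> r_gt0 pr; elim/poly_ind: p => [|p c [w w1 wE]].
  exists 0; last by rewrite horner0 expr0n gtn_eqF.
  by move=> i; rewrite coef0 size_poly0.
exists (w * 'X + (c ^+ r)%:P%:P).
  move=> i; rewrite coefD coefMX coefC; case: i => [|i] /=; last by rewrite addr0.
  by rewrite add0r size_polyC leq_b1.
rewrite hornerMXaddC wE exprDn_pchar; last by rewrite (eq_pnat _ (pchar_poly _)).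
by rewrite exprMn rmorphXn.
Qed.

Lemma coef_sum_scaleXn (S : nzRingType) n (u : 'I_n -> S) (i : 'I_n) :
  (\sum_j u j *: 'X^j)`_i = u i.
Proof.
rewrite coef_sum (bigD1 i) //= coefZ coefXn eqxx mulr1 big1 ?addr0 // => j ji.
by rewrite coefZ coefXn eq_sym val_eqE (negbTE ji) mulr0.
Qed.

Lemma inner_size_le_sum n m (u : 'I_n -> {poly k}) :
  (forall j, (size (u j) <= m)%N) -> inner_size_le m (\sum_j u j *: 'X^j).
Proof.
move=> um i; have [lt_in|le_ni] := ltnP i n.
  by rewrite (coef_sum_scaleXn u (Ordinal lt_in)) um.
rewrite coef_sum big1 ?size_poly0 // => j _.
by rewrite coefZ coefXn gtn_eqF ?mulr0 // (leq_trans (ltn_ord j)).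
Qed.

End InnerSize.

(** * The discriminant of the curve *)

Section ArtinSchreierDiscriminant.
Variables (k : finFieldType) (q : nat) (a s : k).
Hypotheses (q_gt1 : (1 < q)%N) (pq : [pchar k].-nat q).
Hypotheses (odd_k : odd #|k|) (nz_a : a != 0).

(** Over a given [y], the curve equation [y^q - y + s = x + a / x] reads
[x^2 - as_poly(y) x + a = 0], which has discriminant [as_disc(y)]. *)
Definition as_poly : {poly k} := 'X^q - 'X + s%:P.
Definition as_disc : {poly k} := as_poly ^+ 2 - (4 * a)%:P.

Let size_as : size as_poly = q.+1.
Proof.
rewrite /as_poly -addrA size_polyDl ?size_polyXn //.
apply: leq_ltn_trans (size_polyD _ _) _; rewrite gtn_max size_polyN size_polyX.
by rewrite size_polyC !ltnS q_gt1 (leq_trans (leq_b1 _)) // ltnW.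
Qed.

Lemma size_as_disc : size as_disc = (2 * q).+1.
Proof.
have sz : size (as_poly ^+ 2) = (2 * q).+1.
  by rewrite -[LHS]prednK ?size_exp ?size_as ?lt0n ?size_poly_eq0 ?expf_neq0 //=
     -?size_poly_eq0 ?size_as // mulnC.
rewrite /as_disc size_polyDl sz // size_polyN size_polyC.
by rewrite (leq_ltn_trans (leq_b1 _)) // ltnS muln_gt0 /= ltnW.
Qed.

(** [D] is squarefree because [D' = - 2 h], where [h = as_poly] satisfies [h' = -1],
and [D = h^2 - 4 a] shares no factor with [h].  If [P^2 = c Q^2 D] with [P] and
[Q] coprime, then [Q] is constant and [P] divides both [D] and [D'], hence is
constant too, whereas [D] has degree [2 q]. *)
Lemma as_disc_not_square c (P Q : {poly k}) :
  c != 0 -> Q != 0 -> P ^+ 2 != c *: (Q ^+ 2 * as_disc).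
Proof.
have nz2 := two_neq0 odd_k.
have nz4 : (4 : k) != 0 by rewrite (natrM k 2 2) mulf_neq0.
have nzD : as_disc != 0 by rewrite -size_poly_eq0 size_as_disc.
move=> nz_c nzQ; apply/eqP.
wlog cop : P Q nzQ / coprimep P Q => [hw|] PQ.
  have nzG : gcdp P Q != 0 by rewrite gcdp_eq0 negb_and nzQ orbT.
  have nzQ1 : Q %/ gcdp P Q != 0.
    by apply: contra nzQ => /eqP Q0; rewrite -(divpK (dvdp_gcdr P Q)) Q0 mul0r.
  apply: (hw (P %/ gcdp P Q) (Q %/ gcdp P Q)) => //.
    by rewrite coprimep_div_gcd // nzQ orbT.
  apply: (mulIf (expf_neq0 2 nzG)); rewrite /= -exprMn divpK ?dvdp_gcdl // PQ.
  by rewrite -scalerAl [in RHS]mulrAC -exprMn divpK ?dvdp_gcdr.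
have dQP : Q ^+ 2 %| P ^+ 2 by rewrite PQ dvdpZr // dvdp_mulr.
have sQ : size Q == 1%N.
  rewrite -coprimepp; apply: (@coprimep_dvdl _ (P ^+ 2)).
    by rewrite (dvdp_trans _ dQP) // dvdp_mulr.
  by rewrite coprimep_expr // coprimep_sym.
have [u nz_u QE] := size_poly1P _ sQ.
pose c' := c * u ^+ 2.
have nz_c' : c' != 0 by rewrite mulf_neq0 ?expf_neq0.
have PD : P ^+ 2 = c' *: as_disc.
  by rewrite PQ QE -rmorphXn /= mul_polyC scalerA.
have dPD : P %| as_disc by rewrite -(dvdpZr _ _ nz_c') -PD dvdp_mulr.
have q0 : 'X^(q.-1) *+ q = 0 :> {poly k}.
  have q_gt0 := ltnW q_gt1; have dv := pdiv_dvd q.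
  have pk : pdiv q \in [pchar k] by rewrite (pnatPpi pq) // pi_pdiv.
  by rewrite -(divnK dv) mulrnA mulrn_pchar // pchar_poly.
have dh : as_poly^`() = -1.
  by rewrite /as_poly derivD derivB derivXn derivX derivC addr0 q0 sub0r.
have dPh : P %| as_poly.
  have := congr1 deriv PD; rewrite derivZ /as_disc derivB derivC subr0 !deriv_exp.
  rewrite dh /= !expr1 => E.
  rewrite -(dvdpZr _ _ (_ : c' * 2 != 0)) ?mulf_neq0 //.
  have -> : (c' * 2) *: as_poly = - (P^`() * P *+ 2).
    by rewrite E mulN1r mulNrn scalerN opprK -scalerA scaler_nat.
  by rewrite dvdpNr -mulrnAl dvdp_mull.
have : P %| (4 * a)%:P.
  have -> : (4 * a)%:P = as_poly ^+ 2 - as_disc by rewrite /as_disc subKr.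
  by rewrite dvdp_sub // dvdp_mulr.
move/(dvdp_leq _); rewrite polyC_eq0 mulf_neq0 // size_polyC mulf_neq0 // => /(_ isT) sP.
have sE : ((2 * q).+1.-1 = (size P).-1 * 2)%N.
  by rewrite -size_exp PD size_scale // size_as_disc.
move: (size P) sP sE => n; clear -q_gt1; lia.
Qed.

Variables (r t : nat).
Hypotheses (pr : [pchar k].-nat r).
Hypotheses (rE : r = (2 * t).+1) (r_big : (2 * q * q.+1 < r)%N).

Let B := (t.+1 - q)%N.

(** Square the relation.  With [D^(r+1) = D D^r], and [D^r] a polynomial in [y^r], all
inner degrees are below [r], so that the relation persists between polynomials in
two independent variables.  Its leading coefficient in the outer variable then
exhibits [D] as a square up to square factors and constants. *)
Lemma stepanov_nonvanishing (u v : {poly {poly k}}) :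
  inner_size_le B u -> inner_size_le B v ->
  u.['X^r] + v.['X^r] * as_disc ^+ t.+1 = 0 -> u = 0 /\ v = 0.
Proof.
move=> uB vB uv0.
have r_gt0 : (0 < r)%N by rewrite rE.
have [w w1 wE] := pchar_expr_horner_Xn as_disc r_gt0 pr.
have nzDr : as_disc ^+ r != 0 by rewrite expf_neq0 // -size_poly_eq0 size_as_disc.
have nzw : w != 0 by apply: contra nzDr => /eqP w0; rewrite -wE w0 horner0.
have Bq : (2 * B + 2 * q <= r.+1)%N by rewrite /B; nia.
have sqE : u ^+ 2 = v ^+ 2 * as_disc%:P * w.
  apply/eqP; rewrite -subr_eq0; apply/eqP; apply: (@horner_Xn_eq0 _ r).
    apply: inner_size_leB; rewrite !expr2.
      by apply: inner_size_leW (inner_size_leM uB uB); nia.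
    have := inner_size_leM (inner_size_leM (inner_size_leM vB vB)
      (inner_size_leC (leqnn (size as_disc)))) w1.
    by apply: inner_size_leW; rewrite size_as_disc; nia.
  rewrite !hornerE wE; move/eqP: uv0; rewrite addr_eq0 => /eqP ->.
  rewrite sqrrN exprMn -exprM -!mulrA -exprS (_ : t.+1 * 2 = r.+1)%N ?subrr //.
  by rewrite rE; lia.
have [v0|nzv] := eqVneq v 0.
  move/eqP: sqE; rewrite v0 expr0n !mul0r expf_eq0 /= => /eqP.
  by move=> ->.
have := congr1 lead_coef sqE; rewrite lead_coef_exp [in RHS]lead_coefM [in RHS]lead_coefM.
rewrite lead_coef_exp lead_coefC.
have : size (lead_coef w) == 1%N.
  by rewrite eqn_leq lead_coefE w1 lt0n size_poly_eq0 -lead_coefE lead_coef_eq0.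
move=> /size_poly1P[c nz_c ->] /eqP; rewrite mulrC mul_polyC.
by rewrite (negbTE (as_disc_not_square _ nz_c _)) // lead_coef_eq0.
Qed.
End ArtinSchreierDiscriminant.

(** * The auxiliary polynomial of Stepanov's method *)

(** The two numerical facts behind the choice of the degrees: the unknown
coefficients outnumber the conditions, and the resulting degree is
[r^2 / 2 + O(q r)].  Here [t = (r - 1) / 2]. *)
Section StepanovArithmetic.
Local Open Scope nat_scope.
Variables (q r t : nat).
Hypotheses (rE : r = (2 * t).+1) (r_big : 2 * q * q.+1 < r).

Let tE : exists2 u, t = q + u & 2 * q * q.+1 < (2 * (q + u)).+1.
Proof.
exists (t - q); first by rewrite subnKC //; move: r_big; rewrite rE; clear; nia.
rewrite subnKC; first by rewrite -rE.
by move: r_big; rewrite rE; clear; nia.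
Qed.

Lemma stepanov_unknowns :
  r * (t.+1 - q).-1 + (t + q).+1 + q * r.+1
    < (t + q).+1 * (t.+1 - q) + (t + q).+1 * (t.+1 - q).
Proof.
have [u tE' big] := tE; rewrite rE tE'.
have -> : (q + u).+1 - q = u.+1 by clear; lia.
by clear -big; nia.
Qed.

Lemma stepanov_degree m n : m < n ->
  n <= (t.+1 - q) + r * (t + q) + q * r.+1 -> 2 * m <= r ^ 2 + 4 * q * r.
Proof.
have [u tE' _] := tE; rewrite rE tE' -mulnn.
have -> : (q + u).+1 - q = u.+1 by clear; lia.
by clear; nia.
Qed.

End StepanovArithmetic.

Section Stepanov.
Variables (k : finFieldType) (q : nat) (a s : k) (r t : nat).
Hypotheses (q_gt1 : (1 < q)%N) (pq : [pchar k].-nat q).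
Hypotheses (odd_k : odd #|k|) (nz_a : a != 0).
Hypotheses (pr : [pchar k].-nat r) (cardk : #|k| = (r ^ 2)%N).
Hypotheses (rE : r = (2 * t).+1) (r_big : (2 * q * q.+1 < r)%N).

(* [B] is the largest inner size for which the squared relation of
[stepanov_nonvanishing] stays below [r]; [A] then provides enough unknowns. *)
Let A := (t + q).+1.
Let B := (t.+1 - q)%N.
Let D := as_disc q a s.
Let N := (r * B.-1 + A + q * r.+1)%N.

(** A matrix [c] of unknowns, in two versions: [twisted c] enters the auxiliary
polynomial, with [y^b] inside and [y^(r j)] outside, and [plain c] is what its
[r]-th power becomes on [k], where [y^(r^2) = y].  The exponents [b] and [j]
swap roles.  Putting [r]-th powers of the unknowns into [twisted] makes the
conditions on [plain] linear. *)
Let plain (c : 'M[k]_(A, B)) : {poly k} :=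
  \sum_(j < A) \sum_(b < B) c j b *: 'X^(r * b + j).

Let twisted (c : 'M[k]_(A, B)) : {poly {poly k}} :=
  \sum_(j < A) (\sum_(b < B) c j b ^+ r *: 'X^b) *: 'X^j.

Let sum_expr (I : finType) (F : I -> k) : (\sum_i F i) ^+ r = \sum_i F i ^+ r.
Proof.
apply: (big_morph (fun x => x ^+ r)) => [x y|]; first exact: exprDn_pchar.
by rewrite expr0n rE.
Qed.

Let expr_rr (x : k) : (x ^+ r) ^+ r = x.
Proof. by rewrite -exprM mulnn -cardk expf_card. Qed.

Let twisted_frobenius c y : (twisted c).['X^r].[y] ^+ r = (plain c).[y].
Proof.
rewrite /twisted /plain !horner_sum sum_expr; apply: eq_bigr => j _.
rewrite !hornerE !horner_sum exprMn sum_expr mulr_suml; apply: eq_bigr => b _.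
rewrite !hornerE !exprMn expr_rr -mulrA; congr (_ * _).
by rewrite -[X in _ * X]exprM mulnC !exprM expr_rr -!exprM -exprD mulnC.
Qed.

Let twisted_inj c d : twisted c = twisted d -> c = d.
Proof.
move=> cd; apply/matrixP => j b.
have := congr1 (fun w : {poly {poly k}} => (w`_j)`_b) cd.
by rewrite !coef_sum_scaleXn => /(congr1 (fun x => x ^+ r)); rewrite !expr_rr.
Qed.

Let twistedB c d : twisted (c - d) = twisted c - twisted d.
Proof.
rewrite /twisted -sumrB; apply: eq_bigr => j _; rewrite -scalerBl -sumrB.
congr (_ *: _); apply: eq_bigr => b _; rewrite -scalerBl; congr (_ *: _).
rewrite !mxE exprDn_pchar // exprNn -signr_odd.
by rewrite (_ : odd r) ?expr1 ?mulN1r // rE /= mul2n odd_double.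
Qed.

Let plainB c d : plain (c - d) = plain c - plain d.
Proof.
rewrite /plain -sumrB; apply: eq_bigr => j _; rewrite -sumrB.
by apply: eq_bigr => b _; rewrite -scalerBl !mxE.
Qed.

Let size_discX n : (size (D ^+ n) <= (2 * q * n).+1)%N.
Proof. by rewrite (leq_trans (leqSpred _)) // size_exp size_as_disc. Qed.

Let r_gt0 : (0 < r)%N. Proof. by rewrite rE. Qed.

Let exponentE : (2 * q * t.+1 = q * r.+1)%N. Proof. by rewrite rE; lia. Qed.

Let size_plain c : (size (plain c) <= r * B.-1 + A)%N.
Proof.
apply: leq_trans (size_sum _ _ _) _; apply/bigmax_leqP => j _.
apply: leq_trans (size_sum _ _ _) _; apply/bigmax_leqP => b _.
apply: leq_trans (size_scale_leq _ _) _; rewrite size_polyXn.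
have := ltn_ord j; have := ltn_ord b; move: (j : nat) (b : nat) => j' b'; nia.
Qed.

Let size_relation c d : (size (plain c + plain d * D ^+ t.+1)%R <= N)%N.
Proof.
apply: leq_trans (size_polyD _ _) _; rewrite geq_max.
rewrite (leq_trans (size_plain _)) ?leq_addr //=.
apply: leq_trans (size_polyMleq _ _) _.
have := leq_add (size_plain d) (size_discX t.+1).
by rewrite exponentE addnS /N; case: (_ + size _)%N.
Qed.

(** Pigeonhole in place of linear algebra: the difference of two coefficient vectors
with the same image. *)
Let relation_exists : exists c d : 'M[k]_(A, B),
  (c != 0) || (d != 0) /\ plain c + plain d * D ^+ t.+1 = 0.
Proof.
pose f (v : 'M[k]_(A, B) * 'M[k]_(A, B)) : {poly_N k} :=
  npolyp N (plain v.1 + plain v.2 * D ^+ t.+1).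
have : ~~ injectiveb f.
  apply/injectiveP => /leq_card; apply/negP; rewrite -ltnNge.
  rewrite card_npoly card_prod !card_mx -expnD ltn_exp2l ?finNzRing_gt1 //.
  exact: stepanov_unknowns.
case/injectivePn => -[c d] [[c' d'] neq] /(congr1 val) /=.
rewrite !npolypK // => E; exists (c - c'), (d - d').
rewrite !subr_eq0 -negb_and -xpair_eqE neq; split=> //.
by rewrite !plainB mulrBl addrACA -opprD E subrr.
Qed.

Let size_twisted c : (size (twisted c).['X^r] <= B + r * A.-1)%N.
Proof.
rewrite /twisted horner_sum.
apply: leq_trans (size_sum _ _ _) _; apply/bigmax_leqP => j _.
have szu : (size (\sum_(b < B) c j b ^+ r *: 'X^b)%R <= B)%N.
  apply: leq_trans (size_sum _ _ _) _; apply/bigmax_leqP => b _.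
  by apply: leq_trans (size_scale_leq _ _) _; rewrite size_polyXn.
rewrite hornerZ hornerXn -exprM; apply: leq_trans (size_polyMleq _ _) _.
by rewrite size_polyXn addnS /= leq_add // leq_mul2l -ltnS ltn_ord orbT.
Qed.

Let inner_twisted c : inner_size_le B (twisted c).
Proof.
apply: inner_size_le_sum => j.
apply: leq_trans (size_sum _ _ _) _; apply/bigmax_leqP => b _.
by apply: leq_trans (size_scale_leq _ _) _; rewrite size_polyXn.
Qed.

(** If [D(y) = z^2] then [D(y)^((r+1) r / 2) = z^(r^2 + r) = z^(r+1)], which is
[D(y)^((r+1)/2)] again; so the [r]-th power of the auxiliary polynomial takes the
same value at [y] as the relation between the [plain] versions, which vanishes. *)
Lemma card_disc_square :
  (2 * #|[pred y | is_square D.[y]]| <= r ^ 2 + 4 * q * r)%N.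
Proof.
have [c [d [nz_cd rel]]] := relation_exists.
pose S := (twisted c).['X^r] + (twisted d).['X^r] * D ^+ t.+1.
have nzS : S != 0.
  apply/eqP => S0.
  have [c0 d0] := stepanov_nonvanishing q_gt1 pq odd_k nz_a pr rE r_big
    (inner_twisted c) (inner_twisted d) S0.
  have tw0 : twisted 0 = 0 by rewrite -(subrr 0) twistedB subrr.
  by move: nz_cd; rewrite (twisted_inj (d := 0) (etrans c0 (esym tw0)))
    (twisted_inj (d := 0) (etrans d0 (esym tw0))) eqxx.
have szS : (size S <= B + r * A.-1 + q * r.+1)%N.
  apply: leq_trans (size_polyD _ _) _; rewrite geq_max.
  rewrite (leq_trans (size_twisted _)) ?leq_addr //=.
  apply: leq_trans (size_polyMleq _ _) _.
  have := leq_add (size_twisted d) (size_discX t.+1).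
  by rewrite exponentE addnS; case: (_ + size _)%N.
have := max_poly_roots nzS (rs := enum [pred y | is_square D.[y]]).
rewrite -cardE enum_uniq => ltS.
have {}ltS : (#|[pred y | is_square D.[y]]| < size S)%N.
  apply: ltS => //; apply/allP => y; rewrite mem_enum inE => /is_squareP[z Dz].
  suff : S.[y] ^+ r == 0 by rewrite expf_eq0 r_gt0.
  rewrite /S hornerD hornerM exprDn_pchar // exprMn.
  rewrite !twisted_frobenius horner_exp.
  have -> : (D.[y] ^+ t.+1) ^+ r = D.[y] ^+ t.+1.
    have e2 : (2 * t.+1 = r.+1)%N by rewrite rE mulnS.
    rewrite Dz -(exprM z 2) e2 -exprM.
    by rewrite mulSn exprD mulnn -cardk expf_card exprSr.
  by rewrite -horner_exp -hornerM -hornerD rel horner0.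
exact: stepanov_degree ltS szS.
Qed.

End Stepanov.

(** * Points on the curves [y^q - y + s = x + a / x] *)

Section CurvePoints.
Variables (k : finFieldType) (q : nat) (a : k).

Definition curve_point (s : k) (p : k * k) :=
  (p.1 != 0) && (p.2 ^+ q - p.2 + s == p.1 + a / p.1).

(** Over a given [y] the curve equation is quadratic in [x], and [2 x - h] is a square
root of its discriminant. *)
Lemma card_curve_point s : odd #|k| ->
  (#|[pred p | curve_point s p]|
    <= 2 * #|[pred y | is_square (as_disc q a s).[y]]|)%N.
Proof.
move=> odd_k; have nz2 := two_neq0 odd_k.
rewrite -sum1_card (partition_big snd predT) //= mulnC -sum_nat_const.
rewrite [X in (_ <= X)%N]big_mkcond; apply: leq_sum => y _.
pose h := (as_poly q s).[y].
have hE : h = y ^+ q - y + s by rewrite /h /as_poly !hornerE.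
have DE : (as_disc q a s).[y] = h ^+ 2 - 4 * a by rewrite /as_disc hornerD hornerN horner_exp hornerC.
have disc_sqr p : curve_point s p -> p.2 = y -> (2 * p.1 - h) ^+ 2 = (as_disc q a s).[y].
  case/andP=> nz_x /eqP + py; rewrite py -hE DE => ->.
  by field.
rewrite sum1dep_card; case: ifP => [_|/negbT nsq].
  apply: leq_trans (card_sqrt (as_disc q a s).[y]).
  rewrite -(@card_in_imset _ _ (fun p => 2 * p.1 - h)); last first.
    move=> [x1 y1] [x2 y2]; rewrite !inE /= => /andP[_ /eqP->] /andP[_ /eqP->].
    by move/addIr/(mulfI nz2) ->.
  apply: subset_leq_card; apply/subsetP => _ /imsetP[p + ->].
  by rewrite !inE => /andP[cp /eqP py]; rewrite disc_sqr.
rewrite leqn0 cards_eq0; apply/eqP/setP => p; rewrite !inE; apply/negP.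
by case/andP=> cp /eqP py; move: nsq; rewrite inE -(disc_sqr p) // is_square_sqr.
Qed.

(** Every pair [(x, y)] with [x != 0] lies on exactly one of the curves. *)
Lemma sum_curve_point (V : pzRingType) (g : k -> V) :
  \sum_s g s *+ #|[pred p | curve_point s p]|
  = \sum_y \sum_(x | x != 0) g (x + a / x - (y ^+ q - y)).
Proof.
rewrite exchange_big (pair_big _ predT) /=.
under eq_bigr do rewrite -sumr_const.
rewrite (exchange_big_dep (fun p => p.1 != 0)) /=; last by move=> s p _ /andP[].
apply: eq_big => [[x y]|[x y] nz_x] /=; first by rewrite andbT.
rewrite (big_pred1 (x + a / x - (y ^+ q - y))) // => s.
by rewrite !inE /curve_point nz_x /= addrC eq_sym -subr_eq eq_sym.
Qed.

End CurvePoints.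

Section Tower.
Variables (R : realType) (k : finFieldType) (q r m : nat) (psi : k -> R[i]).
Hypotheses (odd_k : odd #|k|) (cardk : #|k| = (r ^ 2)%N) (rE : r = (q ^ m.+1)%N).
Hypotheses (q_gt1 : (1 < q)%N) (r_big : (2 * q * q.+1 < r)%N).
Hypotheses (npsi : nontrivial_character psi).
Hypothesis psi_frob : forall y, psi (y ^+ q) = psi y.

(** Weighting the curves by [psi s] gives [#|k|] times the Kloosterman sum, because
[psi] is trivial on [y^q - y].  The weights sum to zero, so the numbers of points
may be replaced by their defects from the upper bound [N]; the defects are
nonnegative, and their total is known from the number of pairs. *)
Lemma kloosterman_stepanov (a : k) : a != 0 ->
  `|kloosterman psi a| <= (4 * q * r + 1)%:R.
Proof.
move=> nz_a.
have odd_r : odd r by move: odd_k; rewrite cardk oddX.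
have tE : r = (2 * r./2).+1 by rewrite -{1}(odd_double_half r) odd_r mul2n.
have pr : [pchar k].-nat r by apply: (@pchar_nat_card _ _ 1).
have pq : [pchar k].-nat q.
  by apply: (@pchar_nat_card _ _ (m.+1 * 2).-1); rewrite cardk rE -expnM muln2.
pose M s := #|[pred p | curve_point q a s p]|.
pose N := (r ^ 2 + 4 * q * r)%N.
have leMN s : (M s <= N)%N.
  apply: leq_trans (card_curve_point q a s odd_k) _.
  exact: card_disc_square q_gt1 pq odd_k nz_a pr cardk tE r_big.
have k_gt0 : 0 < (#|k|%:R : R[i]) by rewrite ltr0n (ltn_trans _ (finNzRing_gt1 k)).
have SK : \sum_s psi s *+ M s = #|k|%:R * kloosterman psi a.
  rewrite sum_curve_point mulr_natl -sumr_const; apply: eq_bigr => y _.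
  apply: eq_bigr => x _; rewrite (addcharD npsi) (addcharN npsi) [psi (y ^+ q - y)](addcharD npsi).
  by rewrite psi_frob (addcharN npsi) -normCK (addchar_norm npsi) expr1n rmorph1 mulr1.
have S1 : \sum_s (M s)%:R = #|k|%:R * (#|k|.-1)%:R :> R[i].
  rewrite (sum_curve_point q a (fun=> 1)) mulr_natl -sumr_const.
  by apply: eq_bigr => y _; rewrite sumr_const -(cardC1 0).
rewrite -(ler_pM2l k_gt0) -[X in X * _](normr_nat _ #|k|) -normrM -SK.
have -> : \sum_s psi s *+ M s = \sum_s (- (N - M s)%:R) * psi s.
  transitivity (\sum_s psi s *+ M s - N%:R * \sum_s psi s).
    by rewrite (sum_char npsi) mulr0 subr0.
  rewrite mulr_sumr -sumrB; apply: eq_bigr => s _.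
  by rewrite natrB // opprB mulrBl !mulr_natl.
apply: le_trans (ler_norm_sum _ _ _) _.
under eq_bigr do rewrite normrM normrN (addchar_norm npsi) mulr1 normr_nat.
under eq_bigr do rewrite natrB //.
rewrite sumrB S1 sumr_const -[N%:R *+ _]mulr_natl -mulrBr ler_pM2l //.
rewrite lerBlDr -natrD ler_nat /N -cardk.
by have := finNzRing_gt1 k; lia.
Qed.

End Tower.

(** * Weil's bound for Kloosterman sums *)

(** For a field with [Q] elements, [|K|^2 >= (4 + u) Q] implies
[|2 Q - K^2| >= (2 + u) Q], whose square is at least [(4 + 4 u) Q^2]. *)
Lemma kloosterman_tower (R : realType) (F : finFieldType) (chi : F -> R[i])
    (a : F) (e : R[i]) (j : nat) :
  odd #|F| -> nontrivial_character chi -> a != 0 -> 0 <= e ->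
  (4 + e) * #|F|%:R <= `|kloosterman chi a| ^+ 2 ->
  exists (L : finFieldType) (psi : L -> R[i]) (b : L),
  [/\ #|L| = (#|F| ^ (2 ^ j))%N /\ nontrivial_character psi, b != 0,
      (forall y, psi (y ^+ #|F|) = psi y)
    & (4 + 4 ^+ j * e) * #|L|%:R <= `|kloosterman psi b| ^+ 2].
Proof.
move=> oddF nchi nz_a e_ge0 big; elim: j => [|j IHj].
  by exists F, chi, a; split; rewrite ?mul1r // => y; rewrite expf_card.
have [L [psi [b [[cardL npsi] nz_b inv bigL]]]] := IHj.
have oddL : odd #|L| by rewrite cardL oddX oddF orbT.
have [L' [psi' [b' [cardL' npsi' nz_b' inv' KE]]]] := kloosterman_quadratic oddL npsi nz_b.
exists L', psi', b'; split=> //.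
- by split=> //; rewrite cardL' cardL -expnM -expnSr.
- by apply: (inv' _ (2 ^ j).-1) inv; rewrite prednK ?expn_gt0.
rewrite KE cardL'; set K := kloosterman psi b in bigL *.
have je_ge0 : 0 <= 4 ^+ j * e by rewrite mulr_ge0 ?exprn_ge0.
have L_ge0 : 0 <= #|L|%:R :> R[i] by [].
have lowK : (2 + 4 ^+ j * e) * #|L|%:R <= `|2 * #|L|%:R - K ^+ 2|.
  rewrite distrC; apply: le_trans (lerB_dist _ _).
  rewrite normrX normrM !normr_nat lerBrDr -mulrDl.
  by apply: le_trans bigL; rewrite addrAC -natrD.
have low_ge0 : 0 <= (2 + 4 ^+ j * e) * #|L|%:R by rewrite mulr_ge0 // addr_ge0.
apply: le_trans (lerXn2r 2 _ _ lowK); rewrite ?nnegrE //.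
rewrite exprMn natrX ler_wpM2r ?exprn_ge0 // exprS; set u := 4 ^+ j * e.
have -> : (2 + u) ^+ 2 = 4 + 4 * u + u ^+ 2 by ring.
by rewrite -mulrA lerDl exprn_ge0.
Qed.

Lemma stepanov_bound_sqr (q r : nat) : (0 < q -> 0 < r ->
  (4 * q * r + 1) ^ 2 <= 25 * q ^ 2 * r ^ 2)%N.
Proof.
move=> q0 r0; have -> : (25 * q ^ 2 * r ^ 2 = (5 * q * r) ^ 2)%N.
  by rewrite !expnMn.
rewrite leq_sqr -!mulnA (mulnDl 4 1) leq_add2l mul1n muln_gt0.
by rewrite q0 r0.
Qed.

(** An excess [e > 0] of [|K|^2 / q] over [4] would be multiplied by [4] at each step
of the tower, while [(4 q r + 1)^2 <= 25 q^2 r^2] keeps the ratio below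
[25 q^2]. *)
Theorem kloosterman_bound (R : realType) (F : finFieldType) (chi : F -> R[i])
    (a : F) : odd #|F| -> nontrivial_character chi -> a != 0 ->
  `|kloosterman chi a| ^+ 2 <= 4 * #|F|%:R.
Proof.
move=> oddF nchi nz_a; set K := kloosterman chi a; set q := #|F|.
have q_gt2 : (2 < q)%N.
  by have := finNzRing_gt1 F; move: oddF; rewrite -/q; case: q => [|[|[]]].
have q_gt0 : 0 < q%:R :> R[i] by rewrite ltr0n ltnW // ltnW.
rewrite real_leNgt ?realM ?realn ?realX ?normr_real //; apply/negP => gt4.
pose e := `|K| ^+ 2 / q%:R - 4.
have e_gt0 : 0 < e by rewrite subr_gt0 ltr_pdivlMr.
have eE : (4 + e) * q%:R <= `|K| ^+ 2 by rewrite addrC subrK divfK // gt_eqF.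
have [c c_gt0 ce] : exists2 c : R, 0 < c & e = c%:C%C.
  by case: e e_gt0 {eE} => x y; rewrite ltcE /= => /andP[/eqP -> x0]; exists x.
(* The three extra steps ensure [2 q (q + 1) < r] for [r = q^(2^(j-1))]. *)
pose j := (Num.bound ((25 * q ^ 2)%:R / c)).+3.
have [L [psi [b [[cardL npsi] nz_b inv bigL]]]] :=
  kloosterman_tower j oddF nchi nz_a (ltW e_gt0) eE.
have oddL : odd #|L| by rewrite cardL oddX oddF orbT.
pose r := (q ^ 2 ^ j.-1)%N.
have cardr : #|L| = (r ^ 2)%N by rewrite cardL -expnM -expnSr.
have rq : (2 * q * q.+1 < r)%N.
  have : (q ^ 3 <= r)%N.
    rewrite leq_pexp2l ?(ltn_trans _ q_gt2) //.
    by apply: (@leq_trans (2 ^ 2)); rewrite // leq_exp2l.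
  by apply: leq_trans; rewrite !expnS expn0; clear -q_gt2; nia.
have rE : r = (q ^ (2 ^ j.-1).-1.+1)%N by rewrite prednK ?expn_gt0.
have := kloosterman_stepanov oddL cardr rE (ltn_trans _ q_gt2) rq npsi inv nz_b.
move=> /(_ isT) /(lerXn2r 2) => upK.
have {upK} := le_trans bigL (upK _ _); rewrite !nnegrE ler0n normr_ge0 => /(_ isT isT).
have r_gt0 : (0 < r)%N by apply: leq_ltn_trans rq.
have le5 : ((4 * q * r + 1) ^ 2 <= (25 * q ^ 2) * #|L|)%N.
  by rewrite cardr stepanov_bound_sqr // ltnW // ltnW.
rewrite -(natrX _ (4 * q * r + 1)) => upL.
have : (4 + 4 ^+ j * e) * #|L|%:R <= (25 * q ^ 2)%:R * #|L|%:R.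
  by apply: le_trans upL _; rewrite -natrM ler_nat.
rewrite ler_pM2r; last by rewrite ltr0n (ltn_trans _ (finNzRing_gt1 L)).
apply/negP; rewrite lt_geF //.
rewrite ltr_wpDl // ce -[(25 * _)%:R](rmorph_nat (real_complex R)).
rewrite -(rmorph_nat (real_complex R) 4) -rmorphXn -rmorphM /= ltcR.
rewrite -ltr_pdivrMr //; apply: lt_le_trans (archi_boundP _) _.
  by rewrite divr_ge0 // ltW.
rewrite -natrX ler_nat (leq_trans (ltnW (ltn_expl _ (isT : 1 < 4)%N))) //.
by rewrite leq_pexp2l // /j 3?leqW.
Qed.

(** * Quadratic Gauss sums *)

Section GaussSums.
Variables (R : realType) (F : finFieldType) (chi : F -> R[i]).
Hypotheses (oddF : odd #|F|) (nchi : nontrivial_character chi).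

Definition gauss_sum (s : F) : R[i] := \sum_x chi (s * x ^+ 2).

(** After [x = y + v] the phase [s (x^2 - y^2) = s v^2 + 2 s v y] is linear in [y]. *)
Lemma gauss_sum_norm s : s != 0 -> `|gauss_sum s| ^+ 2 = #|F|%:R.
Proof.
move=> nz_s; have nz2 := two_neq0 oddF.
rewrite normCK /gauss_sum rmorph_sum big_distrl /=.
under eq_bigr do rewrite big_distrr /=.
rewrite exchange_big /=.
under eq_bigr => y _ do rewrite (reindex_inj (addrI y)) /=.
rewrite exchange_big (bigD1 0) //= [X in _ + X]big1 ?addr0; last first.
  move=> v nz_v.
  transitivity (\sum_y chi (s * v ^+ 2) * chi (2 * s * v * y)).
    apply: eq_bigr => y _; rewrite -(addcharN nchi) -!(addcharD nchi).
    by congr chi; ring.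
  by rewrite -mulr_sumr (sum_char_scale nchi) !mulf_eq0 (negbTE nz2)
    (negbTE nz_s) (negbTE nz_v) mul0r mulr0.
rewrite (eq_bigr (fun=> 1)) ?sumr_const // => y _.
by rewrite addr0 -(addcharN nchi) -(addcharD nchi) subrr (addchar0 nchi).
Qed.

Lemma gauss_sum_fibers (M s : F) :
  gauss_sum (M * s) = \sum_u #|[pred x : F | M * x ^+ 2 == u]|%:R * chi (s * u).
Proof.
rewrite /gauss_sum (partition_big (fun x => M * x ^+ 2) predT) //=.
apply: eq_bigr => u _; rewrite -sum1_card natr_sum mulr_suml.
by apply: eq_bigr => x /eqP <-; rewrite mul1r mulrA [s * M]mulrC.
Qed.

(** A nonzero [u] is either a square or [M] times a square, and in each case twice. *)
Lemma card_sqrt_nonsquare (M u : F) : ~~ is_square M ->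
  (#|[pred x : F | M * x ^+ 2 == u]%R| + #|[pred x : F | 1 * x ^+ 2 == u]%R| = 2)%N.
Proof.
move=> nsqM; have nzM : M != 0.
  by apply: contra nsqM => /eqP ->; apply/is_squareP; exists 0; rewrite expr0n.
have [->|nz_u] := eqVneq u 0.
  rewrite !(eq_card (_ : _ =i pred1 0)) ?card1 // => x.
    by rewrite !inE mul1r expf_eq0.
  by rewrite !inE mulf_eq0 (negbTE nzM) expf_eq0.
have [/is_squareP[w uE]|nsq_u] := boolP (is_square u).
  have nz_w : w != 0 by move: nz_u; rewrite uE expf_eq0.
  rewrite eq_card0 => [|x].
    rewrite add0n -[RHS](card_sqrt_sqr oddF nz_w); apply: eq_card => x.
    by rewrite !inE mul1r uE.
  rewrite !inE; apply/negP => /eqP MxE; move: nsqM => /negP; apply.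
  have nz_x : x != 0.
    by apply: contra nz_u => /eqP x0; rewrite -MxE x0 expr0n mulr0.
  by apply/is_squareP; exists (w / x); rewrite expr_div_n -uE -MxE mulfK ?expf_neq0.
have /is_squareP[w MuE] := nonsquare_mul nsqM nsq_u.
have nz_w : w != 0.
  by have := mulf_neq0 nzM nz_u; rewrite MuE expf_eq0.
rewrite addnC eq_card0 => [|x].
  rewrite add0n -[RHS](card_sqrt_sqr oddF (_ : w / M != 0)); last by rewrite mulf_neq0 ?invr_neq0.
  have wE : (w / M) ^+ 2 = u / M by rewrite expr_div_n -MuE; field.
  apply: eq_card => x.
  by rewrite !inE wE -[RHS](inj_eq (mulfI nzM)) (mulrC M (u / M)) divfK.
rewrite !inE mul1r; apply/negP => /eqP xE; move: nsq_u => /negP; apply.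
by rewrite -xE is_square_sqr.
Qed.

(** The point is that the sign depends on [M] only.  For a nonsquare [M], [x^2] and
[M x^2] together cover every element twice, so the two Gauss sums cancel. *)
Lemma gauss_sum_scale (M : F) : M != 0 ->
  exists2 e : R[i], e ^+ 2 = 1 & forall s, s != 0 -> gauss_sum (M * s) = e * gauss_sum s.
Proof.
move=> nzM; have [/is_squareP[w ME]|nsq] := boolP (is_square M).
  have nz_w : w != 0 by move: nzM; rewrite ME expf_eq0.
  exists 1 => [|s _]; first by rewrite expr1n.
  rewrite mul1r /gauss_sum [RHS](reindex_inj (mulfI nz_w)).
  by apply: eq_bigr => x _; rewrite ME; congr chi; ring.
exists (-1) => [|s nz_s]; first by rewrite sqrrN expr1n.
rewrite mulN1r; apply/eqP; rewrite -addr_eq0 -[X in gauss_sum X + _]/(M * s).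
rewrite -[X in _ + gauss_sum X]mul1r !gauss_sum_fibers -big_split /=.
under eq_bigr do rewrite -mulrDl -natrD card_sqrt_nonsquare //.
by rewrite -mulr_sumr (sum_char_scale nchi) (negbTE nz_s) mul0r mulr0.
Qed.

Lemma gauss_sum_sqr s : s != 0 -> gauss_sum s ^+ 2 = gauss_sum 1 ^+ 2.
Proof.
move=> nz_s; have [e e2 eE] := gauss_sum_scale nz_s.
by rewrite -[s]mulr1 eE ?oner_eq0 // exprMn e2 mul1r.
Qed.

Lemma quadratic_char_sum (s m : F) : s != 0 ->
  \sum_x chi (s * x ^+ 2 - x * m) = chi (- m ^+ 2 / (4 * s)) * gauss_sum s.
Proof.
move=> nz_s; have nz2 := two_neq0 oddF.
have nz4 : (4 : F) != 0 by rewrite (natrM F 2 2) mulf_neq0.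
rewrite (reindex_inj (addrI (m / (2 * s)))) /gauss_sum mulr_sumr.
apply: eq_bigr => x _; rewrite -(addcharD nchi); congr chi.
by field; rewrite ?nz_s ?nz2 ?nz4.
Qed.

End GaussSums.

(** * Exponential sums over spheres *)

Section SphereSums.
Variables (R : realType) (F : finFieldType) (chi : F -> R[i]).
Hypotheses (oddF : odd #|F|) (nchi : nontrivial_character chi).

Local Notation q := (#|F|%:R : R[i]).
Local Notation gauss := (gauss_sum chi).

(** The contribution of the nontrivial frequencies to the exponential sum over the
sphere of radius [r], with [M] for [|m|^2]. *)
Definition sphere_tail d (r M : F) : R[i] :=
  \sum_(s | s != 0) chi (- (s * r) - M / (4 * s)) * gauss s ^+ d.

Lemma sum_row_prod d (g : 'I_d -> F -> R[i]) :
  \sum_(x : 'rV[F]_d) \prod_j g j (x 0 j) = \prod_j \sum_y g j y.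
Proof.
rewrite bigA_distr_bigA (reindex (fun f : {ffun 'I_d -> F} => \row_j f j)) /=.
  by apply: eq_bigr => f _; apply: eq_bigr => j _; rewrite mxE.
exists (fun x : 'rV[F]_d => [ffun j => x 0 j]) => [f _|x _].
  by apply/ffunP => j; rewrite ffunE mxE.
by apply/rowP => j; rewrite mxE ffunE.
Qed.

Lemma char_sum (I : finType) (f : I -> F) :
  chi (\sum_j f j) = \prod_j chi (f j).
Proof. exact: (big_morph chi (addcharD nchi) (addchar0 nchi)). Qed.

(** Summing over [s] detects [|x|^2 = r]; then the sum over [x] factors into one
quadratic character sum for each coordinate. *)
Lemma sum_sphere d (r : F) (m : 'rV[F]_d) :
  q * \sum_(x in sphere d r) chi (- dotp x m)
  = (m == 0)%:R * q ^+ d + sphere_tail d r (\sum_j m 0 j ^+ 2).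
Proof.
transitivity (\sum_s chi (- (s * r)) *
   \prod_j \sum_y chi (s * y ^+ 2 - y * m 0 j)).
  under [RHS]eq_bigr => s _.
    rewrite -(sum_row_prod (fun j y => chi (s * y ^+ 2 - y * m 0 j))) mulr_sumr.
    over.
  rewrite exchange_big mulr_sumr big_mkcond /=; apply: eq_bigr => x _.
  rewrite inE; set n2 := \sum_j x 0 j ^+ 2.
  transitivity (\sum_s chi ((n2 - r) * s) * chi (- dotp x m)).
    rewrite -mulr_suml (sum_char_scale nchi) subr_eq0.
    by case: eqP; rewrite ?mul1r ?mul0r.
  apply: eq_bigr => s _; rewrite -char_sum -!(addcharD nchi); congr chi.
  by rewrite sumrB -mulr_sumr -/n2 /dotp; ring.
rewrite (bigD1 0) //=; congr (_ + _).
  rewrite mul0r oppr0 (addchar0 nchi) mul1r.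
  under eq_bigr => j _.
    rewrite (eq_bigr (fun y => chi (- m 0 j * y))); last first.
      by move=> y _; rewrite mul0r add0r mulNr mulrC.
    rewrite (sum_char_scale nchi) oppr_eq0.
    over.
  have [->|nz_m] := eqVneq m 0.
    rewrite mul1r (eq_bigr (fun=> q)) ?prodr_const ?card_ord // => j _.
    by rewrite mxE eqxx mul1r.
  rewrite mul0r; apply/eqP/prodf_eq0.
  have /rV0Pn[j nz_mj] := nz_m; exists j => //.
  by rewrite (negbTE nz_mj) mul0r.
apply: eq_bigr => s nz_s.
under eq_bigr do rewrite (quadratic_char_sum oddF nchi) //.
rewrite big_split /= prodr_const card_ord -char_sum mulrA -(addcharD nchi).
congr (chi (_ + _) * _).
by rewrite -mulr_suml sumrN mulNr.
Qed.

Lemma sum_char_neg_scale r : r != 0 ->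
  \sum_(s | s != 0) chi (- (s * r)) = -1.
Proof.
move=> nz_r; under eq_bigr do rewrite mulrC -mulNr.
by rewrite (sum_char_scale_neq0 nchi) oppr_eq0 (negbTE nz_r) mul0r add0r.
Qed.

Lemma gauss_sum_even s n : s != 0 -> gauss s ^+ (2 * n) = gauss 1 ^+ (2 * n).
Proof. by move=> nz_s; rewrite !exprM (gauss_sum_sqr oddF nchi). Qed.

Lemma gauss_sum_even_norm n : `|gauss 1 ^+ (2 * n)| = q ^+ n.
Proof. by rewrite exprM !normrX (gauss_sum_norm oddF nchi) ?oner_eq0. Qed.

Lemma sphere_tail_even n (r M : F) :
  sphere_tail (2 * n) r M =
  gauss 1 ^+ (2 * n) * \sum_(s | s != 0) chi (- (s * r) - M / (4 * s)).
Proof.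
rewrite mulr_sumr; apply: eq_bigr => s nz_s.
by rewrite gauss_sum_even // mulrC.
Qed.

Lemma sphere_tail_even0 n (r : F) : r != 0 ->
  `|sphere_tail (2 * n) r 0| = q ^+ n.
Proof.
move=> nz_r; rewrite sphere_tail_even normrM gauss_sum_even_norm.
under eq_bigr do rewrite mul0r subr0.
by rewrite sum_char_neg_scale // normrN1 mulr1.
Qed.

(** The substitution [s |-> - s / r] turns the sum over [s] into a Kloosterman sum. *)
Lemma sphere_tail_even_bound n (r M : F) : r != 0 ->
  `|sphere_tail (2 * n) r M| ^+ 2 <= 4 * q ^+ (2 * n).+1.
Proof.
move=> nz_r; have q_ge1 : 1 <= q by rewrite ler1n (ltn_trans _ (finNzRing_gt1 F)).
have q4 : 1 <= 4 * q.
  by apply: le_trans q_ge1 _; rewrite ler_peMl // ler1n.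
have nz2 := two_neq0 oddF.
have nz4 : (4 : F) != 0 by rewrite (natrM F 2 2) mulf_neq0.
have [->|nzM] := eqVneq M 0.
  by rewrite sphere_tail_even0 // -exprM mulnC exprS mulrA ler_peMl ?exprn_ge0.
rewrite sphere_tail_even normrM exprMn gauss_sum_even_norm -exprM [(n * 2)%N]mulnC.
rewrite [q ^+ (2 * n).+1]exprS mulrA [leLHS]mulrC ler_pM2r ?exprn_gt0 ?(lt_le_trans ltr01) //.
have -> : \sum_(s | s != 0) chi (- (s * r) - M / (4 * s))
   = kloosterman chi (r * M / 4).
  rewrite /kloosterman (reindex_inj (mulfI (_ : (- r^-1 != 0)))) /=; last first.
    by rewrite oppr_eq0 invr_eq0.
  apply: eq_big => [s|s nz_s].
    by rewrite mulf_eq0 oppr_eq0 invr_eq0 (negbTE nz_r).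
  have {}nz_s : s != 0 by apply: contra nz_s => /eqP ->; rewrite mulr0.
  by congr chi; field; rewrite nz_s nz4 nz_r oppr_eq0 oner_eq0.
by rewrite (kloosterman_bound oddF nchi) // !mulf_neq0 ?invr_neq0.
Qed.

(** For [M != 0], replace [G(s)] by [e G(M s)], with [e^2 = 1].  The phase
[- M / 4 s = - M^2 / (4 M s)] is then exactly what completing the square in
[M s x^2 - x M] produces, and after exchanging the sums only the at most two [x] with [M x^2 = r] contribute. *)
Lemma salie_bound (r M : F) : r != 0 ->
  `|\sum_(s | s != 0) chi (- (s * r) - M / (4 * s)) * gauss s| <= 2 * q.
Proof.
move=> nz_r.
have nz2 := two_neq0 oddF.
have nz4 : (4 : F) != 0 by rewrite (natrM F 2 2) mulf_neq0.
have [->|nzM] := eqVneq M 0.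
  have -> : \sum_(s | s != 0) chi (- (s * r) - 0 / (4 * s)) * gauss s
     = \sum_x \sum_(s | s != 0) chi ((x ^+ 2 - r) * s).
    rewrite exchange_big; apply: eq_bigr => s _; rewrite mulr_sumr.
    apply: eq_bigr => x _; rewrite -(addcharD nchi); congr chi; ring.
  under eq_bigr do rewrite (sum_char_scale_neq0 nchi) subr_eq0.
  rewrite sumrB -mulr_suml -natr_sum sumr_const -[X in _ - X]mul1r -mulrBl.
  rewrite normrM normr_nat ler_wpM2r //.
  have -> : (\sum_x (x ^+ 2 == r) = #|[pred x | x ^+ 2 == r]|)%N.
    by rewrite -sum1_card [RHS]big_mkcond; apply: eq_bigr => x _; rewrite inE; case: eqP.
  have := card_sqrt r; case: #|_| => [|[|[|]]] // _.
  - by rewrite sub0r normrN1 ler1n.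
  - by rewrite subrr normr0.
  - by rewrite [X in `|X - _|]mulr2n addrK normr1 ler1n.
have [e e2 eE] := gauss_sum_scale oddF nchi nzM.
have ne : `|e| = 1.
  by apply/eqP; rewrite -(@pexpr_eq1 _ _ 2) // -normrX e2 normr1.
have -> : \sum_(s | s != 0) chi (- (s * r) - M / (4 * s)) * gauss s
   = e * \sum_x chi (- (x * M)) * \sum_(s | s != 0) chi ((M * x ^+ 2 - r) * s).
  under [in RHS]eq_bigr do rewrite mulr_sumr.
  rewrite [in RHS]exchange_big mulr_sumr; apply: eq_bigr => s nz_s.
  have -> : gauss s = e * gauss (M * s) by rewrite eE // mulrA -expr2 e2 mul1r.
  rewrite mulrCA; congr (_ * _).
  transitivity (chi (- (s * r)) * \sum_x chi (M * s * x ^+ 2 - x * M)).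
    rewrite (quadratic_char_sum oddF nchi) ?mulf_neq0 // mulrA -(addcharD nchi).
    by congr (chi _ * _); field; rewrite ?nz_s ?nzM ?nz4.
  rewrite mulr_sumr; apply: eq_bigr => x _; rewrite -!(addcharD nchi).
  by congr chi; ring.
rewrite normrM ne mul1r.
under eq_bigr do rewrite (sum_char_scale_neq0 nchi) mulrBr mulr1.
rewrite sumrB; under [X in _ - X]eq_bigr do rewrite mulrC -mulNr.
rewrite (sum_char_scale nchi) oppr_eq0 (negbTE nzM) mul0r subr0.
apply: le_trans (ler_norm_sum _ _ _) _.
under eq_bigr do rewrite !normrM (addchar_norm nchi) mul1r !normr_nat subr_eq0.
rewrite -mulr_suml ler_wpM2r // -natr_sum ler_nat.
apply: leq_trans (card_sqrt (r / M)).
rewrite -sum1_card [X in (_ <= X)%N]big_mkcond; apply: leq_sum => x _.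
rewrite inE -[X in (_ <= nat_of_bool X)%N](inj_eq (mulfI nzM)).
by rewrite (mulrC M (r / M)) divfK //; case: eqP.
Qed.

Lemma sphere_tail_odd_bound n (r M : F) : r != 0 ->
  `|sphere_tail (2 * n).+1 r M| <= 2 * q ^+ n.+1.
Proof.
move=> nz_r.
have -> : sphere_tail (2 * n).+1 r M = gauss 1 ^+ (2 * n) *
   \sum_(s | s != 0) chi (- (s * r) - M / (4 * s)) * gauss s.
  rewrite mulr_sumr; apply: eq_bigr => s nz_s.
  by rewrite exprSr gauss_sum_even // mulrCA.
rewrite normrM gauss_sum_even_norm exprSr mulrCA.
by rewrite ler_wpM2l ?exprn_ge0 // salie_bound.
Qed.

Lemma sphere_tail_bound d (r M : F) : r != 0 ->
  `|sphere_tail d r M| ^+ 2 <= 4 * q ^+ d.+1.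
Proof.
move=> nz_r; rewrite -(odd_double_half d) -mul2n; set n := d./2.
case: (odd d); last by rewrite add0n sphere_tail_even_bound.
rewrite add1n; have := sphere_tail_odd_bound n M nz_r.
move=> /(lerXn2r 2) => up; apply: le_trans (up _ _) _; rewrite ?nnegrE ?mulr_ge0 ?exprn_ge0 //.
by rewrite exprMn -(natrX _ 2 2) -exprM mulnC mulnS.
Qed.

(** This smallness against [q^d] is what keeps the sphere nonempty.  In the plane it
needs the exact size [q] of the tail: the general bound [2 q^((d+1)/2)] would be
too weak for small [q]. *)
Lemma sphere_tail0_bound d (r : F) : r != 0 -> (2 <= d)%N ->
  3 * `|sphere_tail d r 0| <= 2 * q ^+ d.
Proof.
move=> nz_r; have q_gt2 : (2 < #|F|)%N.
  by have := finNzRing_gt1 F; move: oddF; case: #|F| => [|[|[]]].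
have q3 : 3 <= q by rewrite ler_nat.
have q1 : 1 <= q by rewrite ler1n ltnW // ltnW.
rewrite -(odd_double_half d) -mul2n; move: (d./2) => n.
case: (odd d) => n_gt; last first.
  rewrite add0n in n_gt *; rewrite sphere_tail_even0 //.
  apply: (@le_trans _ _ (q ^+ n.+1)).
    by rewrite exprS ler_wpM2r ?exprn_ge0.
  apply: (@le_trans _ _ (q ^+ (2 * n))); last by rewrite ler_peMl ?exprn_ge0 // ler1n.
  by rewrite ler_weXn2l //; lia.
rewrite add1n in n_gt *.
apply: (@le_trans _ _ (2 * q ^+ n.+2)).
  rewrite [q ^+ n.+2]exprS mulrCA.
  apply: ler_pM => //; exact: sphere_tail_odd_bound.
by rewrite ler_wpM2l // ler_weXn2l //; lia.
Qed.

End SphereSums.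

(** * Spheres are Salem sets *)

Local Open Scope complex_scope.

Lemma fourier_sphere_bound (R : realType) (F : finFieldType) d (r : F)
    (chi : F -> R[i]) (m : 'rV[F]_d) :
  odd #|F| -> nontrivial_character chi -> (0 < d)%N -> r != 0 -> m != 0 ->
  `|fourier_ind chi (sphere d r) m|
     <= (2 * #|F|%:R ^- d * Num.sqrt (#|F|%:R ^+ (d - 1)))%:C.
Proof.
move=> oddF nchi d_gt0 nz_r nz_m.
have q_gt0 : 0 < #|F|%:R :> R[i] by rewrite ltr0n (ltn_trans _ (finNzRing_gt1 F)).
set Y := Num.sqrt _; set S := \sum_(x in sphere d r) chi (- dotp x m).
have Y2 : Y%:C ^+ 2 = #|F|%:R ^+ (d - 1) :> R[i].
  by rewrite -rmorphXn /= sqr_sqrtr ?exprn_ge0 // rmorphXn rmorph_nat.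
have Y_ge0 : 0 <= Y%:C by rewrite lecR sqrtr_ge0.
have leS : `|S| <= 2 * Y%:C.
  rewrite -(@ler_pXn2r _ 2) ?nnegrE ?mulr_ge0 // -(ler_pM2l (exprn_gt0 2 q_gt0)).
  rewrite exprMn Y2 -exprMn -[X in (X * _) ^+ 2](normr_nat _ #|F|) -normrM.
  rewrite (sum_sphere oddF nchi) (negbTE nz_m) mul0r add0r.
  apply: le_trans (sphere_tail_bound oddF nchi d _ nz_r) _.
  by rewrite mulrCA -exprD (_ : 2 + (d - 1) = d.+1)%N ?expr2 -?natrM //; lia.
rewrite [leRHS](_ : _ = #|F|%:R ^- d * (2 * Y%:C)); last first.
  by rewrite !rmorphM /= fmorphV rmorphXn !rmorph_nat mulrAC mulrC mulrA.
have Q_gt0 : 0 < #|F|%:R ^- d :> R[i] by rewrite invr_gt0 exprn_gt0.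
by rewrite /fourier_ind normrM gtr0_norm // ler_pM2l.
Qed.

Lemma card_sphere_bounds (R : realType) (F : finFieldType) d (r : F) :
  odd #|F| -> (2 <= d)%N -> r != 0 ->
  (#|F| ^ (d - 1) <= 3 * #|sphere d r| <= 5 * #|F| ^ (d - 1))%N.
Proof.
move=> oddF d_ge2 nz_r; have q_gt1 := finNzRing_gt1 F.
have [chi nchi] := nontrivial_character_exists R F.
have := sum_sphere oddF nchi r (0 : 'rV[F]_d).
rewrite eqxx mul1r (eq_bigr (fun=> 1)) => [|x _]; last first.
  rewrite /dotp big1 ?oppr0 ?(addchar0 nchi) // => j _.
  by rewrite mxE mulr0.
rewrite sumr_const big1 => [|j _]; last by rewrite mxE expr0n.
move/eqP; rewrite addrC -subr_eq => /eqP tailE.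
have := sphere_tail0_bound oddF nchi nz_r d_ge2.
have [e dE] : exists e, d = e.+1 by exists d.-1; rewrite prednK // ltnW.
rewrite -tailE -(natrX _ #|F|) -(natrM _ #|F|) dE subn1 /= expnS.
set n := #|sphere _ _|; set w := (#|F| ^ e)%N => le3.
have real_nw (a b : nat) : (a%:R - b%:R : R[i]) \is Num.real by rewrite realB ?realn.
have up : 3 * ((#|F| * n)%:R - (#|F| * w)%:R) <= 2 * (#|F| * w)%:R :> R[i].
  by apply: le_trans le3; apply: ler_wpM2l; rewrite // real_ler_norm.
have low : 3 * ((#|F| * w)%:R - (#|F| * n)%:R) <= 2 * (#|F| * w)%:R :> R[i].
  by apply: le_trans le3; apply: ler_wpM2l; rewrite // distrC real_ler_norm.
move: up low; rewrite !mulrBr !lerBlDr -!natrM -!natrD !ler_nat.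
move: (#|F|) q_gt1 => q q_gt1 {le3 real_nw}.
by move=> up low; apply/andP; split; rewrite -(leq_pmul2l (ltnW q_gt1)); lia.
Qed.

Theorem lemma5p1 (R : realType) (d : nat) (hd : (2 <= d)%N) :
  exists C c1 c2 : R,
    [/\ 0 < C, 0 < c1, 0 < c2 &
      forall (F : finFieldType), odd #|F| ->
      forall r : F, r != 0 ->
        (forall chi : F -> R[i], nontrivial_character chi ->
         forall m : 'rV[F]_d, m != 0 ->
           `| fourier_ind chi (sphere d r) m |
             <= (C * #|F|%:R ^- d * Num.sqrt (#|F|%:R ^+ (d - 1)))%:C)
        /\ c1 * #|F|%:R ^+ (d - 1) <= #|sphere d r|%:R
             <= c2 * #|F|%:R ^+ (d - 1)].
Proof.
exists 2, 3^-1, 2; split; rewrite ?invr_gt0 ?ltr0n // => F oddF r nz_r.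
split=> [chi nchi m nz_m|].
  by apply: fourier_sphere_bound; rewrite // ltnW.
have /andP[low up] := card_sphere_bounds R oddF hd nz_r.
rewrite -natrX; apply/andP; split.
  by rewrite mulrC ler_pdivrMr ?ltr0n // -natrM ler_nat mulnC.
rewrite -natrM ler_nat; lia.
Qed.
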